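(* Let $n\ge 1$ and $x,y\in S_n$. Then there exist an integer $N\geq n$ and permutations $v,w\in S_N$ such that $P(v)=P(w)$, $v(i)=w(i)$ for all $i\leq N-n$, and the pattern of $v$ in the last $n$ positions is $x$ and the pattern of $w$ in the last $n$ positions is $y$.
   Context: Permutations are written in one-line notation. $P(w)$ denotes the Robinson--Schensted insertion tableau of $w\in S_N$, obtained by successively column inserting $w(N),w(N-1),\dots,w(1)$ into the empty tableau (column insertion of $a$: place $a$ in the first column, bumping the smallest entry of that column larger than $a$, if any, which is then inserted into the next column in the same way, and so on). For $x\in S_n$ and $v\in S_N$ with $n\le N$, the pattern of $v$ in the last $n$ positions is $x$ if for all $1\le i<j\le n$: $v(N-n+i)<v(N-n+j)$ if and only if $x(i)<x(j)$. *)

(* Defs.v *)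
From mathcomp Require Import all_boot all_order all_fingroup.
Set Implicit Arguments. Unset Strict Implicit. Unset Printing Implicit Defensive.

(* A tableau is represented as the list of its columns (left to right);
   each column is the list of its entries read top to bottom (increasing). *)
Definition tableau := seq (seq nat).

Fixpoint col_insert (a : nat) (t : tableau) : tableau :=
  match t with
  | [::] => [:: [:: a]]
  | c :: t' =>
      let k := find (fun b => a < b) c in
      if k < size c then set_nth 0 c k a :: col_insert (nth 0 c k) t'
      else rcons c a :: t'
  end.

Definition oneline N (s : 'S_N) : seq nat := [seq val (s i) | i <- enum 'I_N].

Definition Ptab N (s : 'S_N) : tableau := foldr col_insert [::] (oneline s).

Definition last_pattern n N (v : 'S_N) (x : 'S_n) : Prop :=
  forall i j : 'I_n, i < j ->
    (nth 0 (oneline v) (N - n + i) < nth 0 (oneline v) (N - n + j)) = (x i < x j).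

(* Main.v *)
Require Import Defs.
From mathcomp Require Import all_boot all_order all_fingroup.
From mathcomp Require Import zify.

(* Column insertion is invariant under Knuth equivalence, so it is enough to
   find a word [u] such that [u x] and [u y] are Knuth equivalent. Insert by
   rows the letters [a_0 < .. < a_m], in any order, into a row
   [b_0 < .. < b_(m-1)] with [a_i < b_i < a_(i+1)]: each [a_i] with [i < m] bumps
   [b_i] and [a_m] is appended. The row becomes [a_0 .. a_m], and the bumped word
   has the same pattern with its largest letter removed. Stacking such rows of
   lengths [n-1, n-2, .., 0] erases all information on the order of the last [n]
   letters. The letters of [0, n^2) that do not occur are put in front. *)

(** * Column insertion into weakly increasing columns *)

Lemma col_insert_bump (a : nat) (C L : seq nat) (b : nat) (R : seq nat)
    (T : tableau) :
  C = L ++ b :: R -> all (leq^~ a) L -> a < b ->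
  col_insert a (C :: T) = (L ++ a :: R) :: col_insert b T.
Proof.
move=> -> La ab /=.
have Hk : find (fun c => a < c) (L ++ b :: R) = size L.
  rewrite find_cat /= ab addn0 (negbTE (_ : ~~ has _ _)) //.
  by rewrite -all_predC; apply: sub_all La => c /=; lia.
rewrite Hk size_cat /= -ltn_subLR // subnn /= nth_cat ltnn subnn /=.
congr (_ :: _); elim: L {La Hk} => //= c L ->//.
Qed.

Lemma col_insert_rcons (a : nat) (L : seq nat) (T : tableau) :
  all (leq^~ a) L -> col_insert a (L :: T) = rcons L a :: T.
Proof.
move=> La /=; rewrite ltnNge (_ : size L <= _) //.
by rewrite leqNgt -has_find -all_predC; apply: sub_all La => c /=; lia.
Qed.

(** Lets the empty tableau be treated as one empty column, so that the one-column lemmas also serve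
    the base case. *)
Lemma col_insert_nil (a : nat) : col_insert a [::] = col_insert a [:: [::]].
Proof. by []. Qed.

Lemma sorted_split (a : nat) (C : seq nat) : sorted leq C ->
  exists L R, [/\ C = L ++ R, all (leq^~ a) L & all (ltn a) R].
Proof.
elim: C => [|c C IH] /= sC; first by exists [::], [::].
case: (leqP c a) => ca.
  have [L [R [-> La Ra]]] := IH (path_sorted sC).
  by exists (c :: L), R; rewrite /= ca La.
exists [::], (c :: C); split=> //=; apply/andP; split=> //.
have := order_path_min leq_trans sC; apply: sub_all => d /=; lia.
Qed.

Local Notation sorted_cols := (all (sorted leq)).

(** Keeps the Knuth relations, proved for sorted columns, available after any suffix of a word has
    been inserted. *)
Lemma sorted_cols_insert (a : nat) (T : tableau) :
  sorted_cols T -> sorted_cols (col_insert a T).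
Proof.
elim: T a => [//|C T IH] a sCT.
have {sCT} [sC sT] : sorted leq C /\ sorted_cols T by apply/andP.
have [L [R [eC La Ra]]] := sorted_split a _ sC; subst C.
move: sC; rewrite sorted_pairwise; last exact: leq_trans.
rewrite pairwise_cat => /and3P[LR sL sR].
case: R Ra LR sR => [|b R] Ra LR sR.
  rewrite cats0 col_insert_rcons //= sT andbT.
  rewrite sorted_pairwise; last exact: leq_trans.
  by rewrite pairwise_rcons La.
have [ab Rb] : a < b /\ all (ltn a) R by apply/andP.
have [bR sR'] : all (leq b) R /\ pairwise leq R by apply/andP.
rewrite (@col_insert_bump a _ L b R) //= IH // andbT.
rewrite sorted_pairwise; last exact: leq_trans.
rewrite pairwise_cat /= sL sR' !andbT allrel_consr La /=.
have -> : allrel leq L R by move: LR; rewrite allrel_consr => /andP[].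
by apply: sub_all Rb => d /=; lia.
Qed.

Lemma sorted_cols_foldr (w : seq nat) (T : tableau) :
  sorted_cols T -> sorted_cols (foldr col_insert T w).
Proof. by move=> sT; elim: w => //= a w; apply: sorted_cols_insert. Qed.

(** * Invariance of column insertion under the Knuth relations *)

Lemma sub_all_leq (a b : nat) (s : seq nat) :
  a <= b -> all (leq^~ a) s -> all (leq^~ b) s.
Proof. by move=> ab; apply: sub_all => c /=; lia. Qed.

Local Arguments col_insert : simpl never.

Ltac split_bools := repeat match goal with
  | H : is_true (all _ (_ ++ _)) |- _ => rewrite all_cat in H
  | H : is_true (all _ (_ :: _)) |- _ => rewrite /= in H
  | H : is_true (sorted _ (_ :: _)) |- _ => rewrite /= in H
  | H : is_true (_ && _) |- _ => case/andP: H => ? ? end.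
Ltac arith := repeat match goal with
  | H : is_true (all _ _) |- _ => clear H
  | H : is_true (path _ _ _) |- _ => clear H
  | H : is_true (sorted _ _) |- _ => clear H end; lia.
Ltac side := match goal with
  | |- @eq (seq nat) _ _ => by rewrite -?cats1 -?catA /= -?catA
  | |- is_true (all _ _) => rewrite -?cats1 ?all_cat /= ?all_cat /=; split_bools;
      repeat (apply/andP; split); first [done | arith]
  | _ => split_bools; arith end.
(** The splitting of the column around the bumped entry [b] is given by hand and checked by [side];
    [app] is the case where nothing is bumped. *)
Ltac bump a L b R := match goal with |- context [col_insert a (?C :: ?T)] =>
  rewrite (@col_insert_bump a C L b R T); [|side..] end.
Ltac app a := match goal with |- context [col_insert a (?C :: ?T)] =>
  rewrite (@col_insert_rcons a C T); [|side] end.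

(* Columns are allowed to increase only weakly: then no distinctness hypothesis
   on the letters and the entries is needed, and the induction on the columns
   goes through because a bumped triple again satisfies one of the two relations. *)
Lemma col_insert_knuth (T : tableau) : sorted_cols T ->
  (forall x y z, x <= y < z ->
     col_insert y (col_insert x (col_insert z T))
     = col_insert y (col_insert z (col_insert x T))) /\
  (forall x y z, x < y <= z ->
     col_insert x (col_insert z (col_insert y T))
     = col_insert z (col_insert x (col_insert y T))).
Proof.
elim: T => [_|C T IH sCT].
  split=> x y z /andP[xy yz].
    rewrite !(col_insert_nil z) !(col_insert_nil x).
    app z. app x. bump x (@nil nat) z (@nil nat). app z. bump y [:: x] z (@nil nat).
    by app y.
  rewrite !(col_insert_nil y). app y. app z. bump x (@nil nat) y [:: z].
  bump x (@nil nat) y (@nil nat). by app z.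
have {sCT} [sC sT] : sorted leq C /\ sorted_cols T by apply/andP.
have [K1 K2] := IH sT; split=> x y z /andP[xy yz].
  (* The column is cut as [L <= x < Y <= y < Z <= z < E]. Which blocks are empty decides what is
     bumped, always the head of a block or a letter just inserted, except for [r] below. *)
  have [L [D [eC Lx Dx]]] := sorted_split x _ sC; subst C.
  have sD := (cat_sorted2 sC).2.
  have [Y [F [eD Yy Fy]]] := sorted_split y _ sD; subst D.
  have sF := (cat_sorted2 sD).2.
  have [Z [E [eF Zz Ez]]] := sorted_split z _ sF; subst F.
  have Ly : all (leq^~ y) L by apply: sub_all_leq Lx.
  have Lz : all (leq^~ z) L by apply: sub_all_leq Ly; exact: ltnW.
  have Yz : all (leq^~ z) Y by apply: sub_all_leq Yy; exact: ltnW.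
  case: Y Z sD sC sF Dx Yy Fy Yz Zz => [|m Y] [|p Z] /=.
  - case: E Ez => [|b [|r E]] /= Ez sD sC sF Dx Yy Fy Yz Zz.
    + rewrite cats0. app z. app x.
      bump x L z (@nil nat). app z. bump y (rcons L x) z (@nil nat).
      app y. by rewrite !cats1.
    + bump z L b (@nil nat). bump x L z (@nil nat). bump x L b (@nil nat).
      rewrite cats1. app y. app z. bump y (rcons L x) z (@nil nat).
      by rewrite cats1.
    (* Here the relation changes: one order bumps [b, z, r], the other [b, r, z], with [z < b <= r].
       Hence both relations are proved together. *)
    + bump z L b (r :: E). bump x L z (r :: E). bump x L b (r :: E).
      bump y (L ++ [:: x]) r E. bump z (L ++ [:: x]) r E.
      bump y (L ++ [:: x]) z E.
      congr (_ :: _); symmetry; apply: K2; side.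
  - case: Z => [|q Z] /=; case: E Ez => [|e E] /= Ez sD sC sF Dx Yy Fy Yz Zz.
    + app z. bump x L p [:: z]. bump x L p (@nil nat). app z.
      bump y (rcons L x) z (@nil nat).
      by bump y (rcons L x) z (@nil nat).
    + bump z (L ++ [:: p]) e E. bump x L p (z :: E). bump x L p (e :: E).
      bump y (L ++ [:: x]) z E. bump z (L ++ [:: x]) e E.
      bump y (L ++ [:: x]) z E. congr (_ :: _); apply: K1; side.
    + rewrite cats0. app z. bump x L p (q :: Z ++ [:: z]). bump x L p (q :: Z). app z.
      bump y (L ++ [:: x]) q (Z ++ [:: z]). by bump y (L ++ [:: x]) q (Z ++ [:: z]).
    + bump z (L ++ p :: q :: Z) e E. bump x L p (q :: Z ++ z :: E).
      bump x L p (q :: Z ++ e :: E). bump y (L ++ [:: x]) q (Z ++ z :: E).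
      bump z (L ++ x :: q :: Z) e E. bump y (L ++ [:: x]) q (Z ++ z :: E).
      congr (_ :: _); apply: K1; side.
  - case: E Ez => [|e E] /= Ez sD sC sF Dx Yy Fy Yz Zz; rewrite ?cats0.
    + app z. bump x L m (Y ++ [:: z]). bump x L m Y. app z.
      bump y (L ++ x :: Y) z (@nil nat). by bump y (L ++ x :: Y) z (@nil nat).
    + bump z (L ++ m :: Y) e E. bump x L m (Y ++ z :: E). bump x L m (Y ++ e :: E).
      bump z (L ++ x :: Y) e E. bump y (L ++ x :: Y) z E. bump y (L ++ x :: Y) z E.
      congr (_ :: _); apply: K1; side.
  - case: E Ez => [|e E] /= Ez sD sC sF Dx Yy Fy Yz Zz; rewrite ?cats0.
    + app z. bump x L m (Y ++ p :: Z ++ [:: z]). bump x L m (Y ++ p :: Z). app z.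
      bump y (L ++ x :: Y) p (Z ++ [:: z]). by bump y (L ++ x :: Y) p (Z ++ [:: z]).
    + bump z (L ++ m :: Y ++ p :: Z) e E. bump x L m (Y ++ p :: Z ++ z :: E).
      bump x L m (Y ++ p :: Z ++ e :: E). bump z (L ++ x :: Y ++ p :: Z) e E.
      bump y (L ++ x :: Y) p (Z ++ z :: E). bump y (L ++ x :: Y) p (Z ++ z :: E).
      congr (_ :: _); apply: K1; side.
(* Now [y] enters first. Afterwards [x] acts at or above the cell of [y] and [z] strictly below it,
   so both orders give the same column and only the bumped letters remain to be compared. *)
have [P [D [eC Py Dy]]] := sorted_split y _ sC; subst C.
have [sP sD] := cat_sorted2 sC.
have [L [R [eP Lx Rx]]] := sorted_split x _ sP; subst P.
have Lz : all (leq^~ z) L by apply: sub_all_leq Lx; lia.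
have Rz : all (leq^~ z) R.
  by move: Py; rewrite all_cat => /andP[_]; apply: sub_all_leq.
have [->|[d [D' eD]]] : D = [::] \/ exists d D', D = d :: D'.
- by case: (D) => [|d D']; [left|right; exists d, D'].
- rewrite cats0; app y. app z. case: R sC sP Py Rx Rz => [|r R] sC sP Py Rx Rz.
  + bump x L y [:: z]. bump x L y (@nil nat). app z. by rewrite -?cats1 -?catA /= -?catA.
  + bump x L r (R ++ [:: y; z]). bump x L r (R ++ [:: y]). app z.
    by rewrite -?cats1 -?catA /= -?catA.
subst D; bump y (L ++ R) d D'.
have [Z [E [eF Zz Ez]]] := sorted_split z _ (cat_sorted2 (s := [:: d]) sD).2; subst D'.
have dE : all (leq d) (Z ++ E) by exact: order_path_min leq_trans sD.
case: E R Ez dE sC sD Dy sP Py Rx Rz => [|e E] [|r R] Ez dE sC sD Dy sP Py Rx Rz.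
- rewrite !cats0; app z. bump x L y (Z ++ [:: z]). bump x L y Z. app z.
  by rewrite -?cats1 -?catA /= -?catA.
- rewrite !cats0; app z. bump x L r (R ++ y :: Z ++ [:: z]).
  bump x L r (R ++ y :: Z). app z. by rewrite -?cats1 -?catA /= -?catA.
- bump z (L ++ y :: Z) e E. bump x L y (Z ++ z :: E). bump x L y (Z ++ e :: E).
  bump z (L ++ x :: Z) e E. rewrite -!catA; congr (_ :: _); apply: K2. side.
- bump z (L ++ r :: R ++ y :: Z) e E. bump x L r (R ++ y :: Z ++ z :: E).
  bump x L r (R ++ y :: Z ++ e :: E). bump z (L ++ x :: R ++ y :: Z) e E.
  rewrite -!catA /= -!catA; congr (_ :: _); apply: K2. side.
Qed.

(** * Knuth equivalence of words *)

(** Defined by the action on tableaux rather than generated by Knuth moves. Quantifying over [T] is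
    what allows a common suffix, which is inserted first. *)
Definition knuth_eq (w w' : seq nat) := forall T, sorted_cols T ->
  foldr col_insert T w = foldr col_insert T w'.

Lemma knuth_eq_trans (w2 w1 w3 : seq nat) :
  knuth_eq w1 w2 -> knuth_eq w2 w3 -> knuth_eq w1 w3.
Proof. by move=> e12 e23 T sT; rewrite e12 ?e23. Qed.

Lemma knuth_eq_sym (w w' : seq nat) : knuth_eq w w' -> knuth_eq w' w.
Proof. by move=> e T sT; rewrite e. Qed.

Lemma knuth_eq_catl (p w w' : seq nat) :
  knuth_eq w w' -> knuth_eq (p ++ w) (p ++ w').
Proof. by move=> e T sT; rewrite !foldr_cat e. Qed.

Lemma knuth_eq_catr (q w w' : seq nat) :
  knuth_eq w w' -> knuth_eq (w ++ q) (w' ++ q).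
Proof. by move=> e T sT; rewrite !foldr_cat e //; apply: sorted_cols_foldr. Qed.

Lemma knuth_eq_yxz (x y z : nat) (q : seq nat) : x <= y < z ->
  knuth_eq [:: y, x, z & q] [:: y, z, x & q].
Proof.
move=> xyz; apply: (@knuth_eq_catr q [:: y; x; z] [:: y; z; x]) => T sT.
exact: (col_insert_knuth T sT).1.
Qed.

Lemma knuth_eq_xzy (x y z : nat) (q : seq nat) : x < y <= z ->
  knuth_eq [:: x, z, y & q] [:: z, x, y & q].
Proof.
move=> xyz; apply: (@knuth_eq_catr q [:: x; z; y] [:: z; x; y]) => T sT.
exact: (col_insert_knuth T sT).2.
Qed.

(** * Row insertion by Knuth moves, and interlaced rows *)

(** The letter [a] travels left through [M]; its exchange with [m] is allowed by the letter just
    before [m], which lies between [a] and [m]. *)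
Lemma row_bumpr (a b : nat) (M : seq nat) :
  a < b -> path ltn b M -> knuth_eq (b :: M ++ [:: a]) [:: b, a & M].
Proof.
elim: M b => [//|m M IH] b ab /= /andP[bm Mm].
apply: (@knuth_eq_trans [:: b, m, a & M]).
  by apply: (@knuth_eq_catl [:: b]); apply: IH; lia.
by apply/knuth_eq_sym/knuth_eq_yxz; lia.
Qed.

(** The letter [b] travels left through [L]; its exchange with [l] is allowed by the letter that
    follows, the next one of [L] or [a], which lies between [l] and [b]. *)
Lemma row_bumpl (a b : nat) (L M : seq nat) :
  sorted ltn (rcons L a) -> all (ltn^~ b) (rcons L a) ->
  knuth_eq (L ++ [:: b, a & M]) (b :: L ++ a :: M).
Proof.
elim: L => [//|l L IH] sL /= /andP[lb Lb].
apply: (knuth_eq_trans [:: l, b & L ++ a :: M]).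
  by apply: (knuth_eq_catl [:: l]); apply: IH => //; apply: path_sorted sL.
case: L sL Lb {IH} => [|m L] /= /andP[lm _] /andP[mb _];
  apply: knuth_eq_xzy; lia.
Qed.

(* Schensted row insertion, read as a Knuth equivalence: [a] bumps [b]. *)
Lemma row_bump (a b : nat) (L M : seq nat) :
  a < b -> sorted ltn (rcons L a) -> sorted ltn (b :: M) ->
  knuth_eq (L ++ b :: M ++ [:: a]) (b :: L ++ a :: M).
Proof.
move=> ab La bM; apply: (knuth_eq_trans (L ++ [:: b, a & M])).
  exact/knuth_eq_catl/row_bumpr.
apply: row_bumpl => //; rewrite all_rcons /= ab /=.
move: La; rewrite sorted_pairwise; last exact: ltn_trans.
by rewrite pairwise_rcons => /andP[La _]; apply: sub_all La => c /= ?; lia.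
Qed.

(* The rows are interlaced: [entry n k i < entry n k.+1 i < entry n k i.+1]
   as long as [k.+1 < n]. *)
Definition entry (n k i : nat) := i * n + k.

Definition mixed_entry (n k : nat) (P : seq nat) (j : nat) :=
  if j \in P then entry n k j else entry n k.+1 j.

(* The row [entry n k.+1 0, .., entry n k.+1 m.-1] after the insertion of
   [entry n k i] for [i] in [P]. *)
Definition mixed_row (n k m : nat) (P : seq nat) :=
  map (mixed_entry n k P) (iota 0 (m + (m \in P))).

Lemma mixed_entry_mono (n k : nat) (P : seq nat) :
  k.+1 < n -> {homo mixed_entry n k P : i j / i < j}.
Proof. by move=> kn i j ij; rewrite /mixed_entry /entry; do 2 case: ifP => _; nia. Qed.

Lemma mixed_row_sorted (n k i m : nat) (P : seq nat) :
  k.+1 < n -> sorted ltn (map (mixed_entry n k P) (iota i m)).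
Proof. by move=> kn; apply: homo_sorted (iota_ltn_sorted i m); apply: mixed_entry_mono. Qed.

Lemma eq_mixed_row (n k i j m : nat) (P : seq nat) : i < j \/ j + m <= i ->
  map (mixed_entry n k (i :: P)) (iota j m) = map (mixed_entry n k P) (iota j m).
Proof.
move=> ij; apply/eq_in_map => l; rewrite mem_iota /mixed_entry inE => jlm.
by rewrite (_ : (l == i) = false) //; lia.
Qed.

(** By interlacing, [entry n k i] exceeds everything before position [i] and is below the old entry
    there, whatever [P] is. So it bumps that entry, or is appended when [i = m]. *)
Lemma mixed_row_insert (n k m i : nat) (P : seq nat) :
  k.+1 < n -> i <= m -> i \notin P ->
  knuth_eq (mixed_row n k m P ++ [:: entry n k i])
    ((if i < m then [:: entry n k.+1 i] else [::]) ++ mixed_row n k m (i :: P)).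
Proof.
move=> kn im iP; rewrite /mixed_row inE.
have ei : mixed_entry n k (i :: P) i = entry n k i by rewrite /mixed_entry mem_head.
case: ltnP => mi; last first.
  have {mi im} em : i = m by lia.
  subst i.
  rewrite (negbTE iP) eqxx addn0 addn1 -addn1 iotaD map_cat /= ei eq_mixed_row //.
  by right.
rewrite (_ : (m == i) = false) /=; last by lia.
(* Cuts the row into the positions before [i], position [i] and [r] later ones, whether or not the
   letter of index [m] has already been appended. *)
have -> : m + (m \in P) = i + (m + (m \in P) - i.+1).+1 by lia.
move: (m + _ - _) => r.
have bi : mixed_entry n k P i = entry n k.+1 i by rewrite /mixed_entry (negbTE iP).
rewrite !iotaD !map_cat /= add0n ei bi !eq_mixed_row; [|lia..].
rewrite -catA /=; apply: row_bump.
- by rewrite /entry; lia.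
- have := mixed_row_sorted n k 0 i.+1 (i :: P) kn.
  by rewrite -addn1 iotaD map_cat /= add0n ei eq_mixed_row ?cats1 //; right.
- by have := mixed_row_sorted n k i r.+1 P kn; rewrite /= bi.
Qed.

(** Bumped letters leave on the left in the order of [s]; index [m] bumps nothing. The use of
    [catrev] follows the growth of [P] in the induction. *)
Lemma mixed_row_inserts (n k m : nat) (s P : seq nat) :
  k.+1 < n -> all (leq^~ m) s -> uniq (catrev s P) ->
  knuth_eq (mixed_row n k m P ++ map (entry n k) s)
    (map (entry n k.+1) [seq i <- s | i < m] ++ mixed_row n k m (catrev s P)).
Proof.
move=> kn; elim: s P => [|i s IH] P /=; first by rewrite cats0.
move=> /andP[im sm] uP.
have iP : i \notin P.
  by move: uP; rewrite catrevE cat_uniq /= => /and3P[_ _ /andP[]].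
apply: (@knuth_eq_trans ((mixed_row n k m P ++ [:: entry n k i]) ++ map (entry n k) s)).
  by rewrite -catA.
apply: (knuth_eq_trans _ _ _ (knuth_eq_catr _ _ _ (mixed_row_insert _ _ _ _ _ kn im iP))).
rewrite -catA; apply: (knuth_eq_trans _ _ _ (knuth_eq_catl _ _ _ (IH _ sm uP))).
by rewrite catA; case: ifP.
Qed.

(** Once all letters are in, the row has forgotten [s]; only the bumped word, one letter shorter,
    remembers its order. *)
Lemma row_inserts (n k m : nat) (s : seq nat) :
  k.+1 < n -> perm_eq s (iota 0 m.+1) ->
  knuth_eq (map (entry n k.+1) (iota 0 m) ++ map (entry n k) s)
    (map (entry n k.+1) [seq i <- s | i < m] ++ map (entry n k) (iota 0 m.+1)).
Proof.
move=> kn sm.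
have s_in j : (j \in s) = (j < m.+1) by rewrite (perm_mem sm) mem_iota.
have := @mixed_row_inserts n k m s [::] kn.
rewrite /mixed_row addn0 catrevE cats0 mem_rev s_in leqnn addn1 rev_uniq.
rewrite (_ : map (mixed_entry n k (rev s)) _ = map (entry n k) (iota 0 m.+1)).
  apply; last by rewrite (perm_uniq sm) iota_uniq.
  by apply/allP => j; rewrite s_in.
by apply/eq_in_map => j; rewrite mem_iota /= => jm; rewrite /mixed_entry mem_rev s_in jm.
Qed.

(** * The staircase of rows *)

(** Rows of lengths [0, 1, .., m.-1]. The longest, of index [k.+1], stands last, next to the letters
    [entry n k i] that it receives. *)
Fixpoint staircase (n m k : nat) : seq nat :=
  if m is m'.+1 then staircase n m' k.+1 ++ map (entry n k.+1) (iota 0 m') else [::].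

Lemma staircaseS (n m k : nat) :
  staircase n m.+1 k = staircase n m k.+1 ++ map (entry n k.+1) (iota 0 m).
Proof. by []. Qed.

Lemma staircase_knuth_eq (n m k : nat) (s s' : seq nat) :
  k + m <= n -> perm_eq s (iota 0 m) -> perm_eq s' (iota 0 m) ->
  knuth_eq (staircase n m k ++ map (entry n k) s)
           (staircase n m k ++ map (entry n k) s').
Proof.
elim: m k s s' => [|m IH] k s s' kmn sm sm'.
  by rewrite (perm_nilP sm) (perm_nilP sm').
(* One letter has only one order. The bound [k.+1 < n] needed for interlacing is guaranteed from two
   letters on. *)
case: m => [|m] in IH kmn sm sm' *.
  by rewrite (perm_small_eq _ sm) // (perm_small_eq _ sm').
have kn : k.+1 < n by lia.
have filt t : perm_eq t (iota 0 m.+2) -> perm_eq [seq i <- t | i < m.+1] (iota 0 m.+1).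
  move=> tm; apply: uniq_perm; rewrite ?iota_uniq ?filter_uniq ?(perm_uniq tm) ?iota_uniq //.
  by move=> j; rewrite mem_filter (perm_mem tm) !mem_iota; lia.
rewrite (staircaseS n m.+1 k) -2!catA.
apply: (knuth_eq_trans _ _ _ (knuth_eq_catl _ _ _ (row_inserts _ _ _ _ kn sm))).
apply/knuth_eq_sym.
apply: (knuth_eq_trans _ _ _ (knuth_eq_catl _ _ _ (row_inserts _ _ _ _ kn sm'))).
by rewrite !catA; apply/knuth_eq_catr/IH; rewrite ?filt //; lia.
Qed.

(** The residue modulo [n] is the index of the row, which separates the letters of different
    rows. *)
Lemma staircase_residue (n m k : nat) : k + m <= n ->
  all (fun a => (k < a %% n) && (a < n * n)) (staircase n m k).
Proof.
elim: m k => [//|m IH] k kmn; rewrite staircaseS all_cat; apply/andP; split.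
  have kmn' : k.+1 + m <= n by lia.
  by apply: sub_all (IH _ kmn') => a /=; lia.
apply/allP => a /mapP[i]; rewrite mem_iota => im -> {a}.
rewrite /entry modnMDl modn_small; last by lia.
by rewrite ltnSn /=; nia.
Qed.

Lemma map_entry_uniq (n k : nat) (s : seq nat) :
  0 < n -> uniq s -> uniq (map (entry n k) s).
Proof. by move=> n0 us; rewrite map_inj_uniq // => i j; rewrite /entry; nia. Qed.

Lemma staircase_uniq (n m k : nat) (s : seq nat) :
  k + m <= n -> k < n -> uniq s -> uniq (staircase n m k ++ map (entry n k) s).
Proof.
elim: m k s => [|m IH] k s kmn kn us; first by apply: map_entry_uniq => //; lia.
rewrite cat_uniq map_entry_uniq ?andbT; [|lia|by []].
apply/andP; split; last first.
  apply/hasPn => _ /mapP[i _ ->]; apply/negP => /(allP (staircase_residue n m.+1 k kmn)).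
  by rewrite /entry modnMDl modn_small ?ltnn.
case: m => [|m] in IH kmn *; first by [].
by apply: IH; rewrite ?iota_uniq //; lia.
Qed.

(** * One-line words and the final permutations *)

Lemma oneline_perm (N : nat) (x : 'S_N) : perm_eq (oneline x) (iota 0 N).
Proof.
apply: uniq_perm; rewrite ?iota_uniq //.
  by rewrite map_inj_uniq ?enum_uniq // => i j /val_inj/perm_inj.
move=> j; rewrite mem_iota /=; apply/mapP/idP => [[i _ ->]|jN]; first exact: ltn_ord.
by exists (perm_inv x (Ordinal jN)); rewrite ?mem_enum // permKV.
Qed.

Lemma size_oneline (N : nat) (x : 'S_N) : size (oneline x) = N.
Proof. by rewrite size_map size_enum_ord. Qed.

Lemma nth_oneline (N : nat) (x : 'S_N) (i : 'I_N) : nth 0 (oneline x) i = x i.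
Proof. by rewrite (nth_map i) ?size_enum_ord // nth_ord_enum. Qed.

Lemma oneline_surj (N : nat) (s : seq nat) :
  perm_eq s (iota 0 N) -> exists v : 'S_N, oneline v = s.
Proof.
move=> sN; have sz : size s = N by rewrite (perm_size sN) size_iota.
have lt_s (i : 'I_N) : nth 0 s i < N.
  by have := mem_nth 0 (_ : i < size s); rewrite (perm_mem sN) mem_iota sz; apply.
have inj : injective (fun i => Ordinal (lt_s i)).
  move=> i j [] /eqP; rewrite nth_uniq ?sz // ?(perm_uniq sN) ?iota_uniq //.
  by move/eqP/val_inj.
exists (perm inj); apply: (@eq_from_nth _ 0); rewrite size_oneline ?sz // => i iN.
by rewrite (nth_oneline _ _ (Ordinal iN)) permE.
Qed.

Theorem theorem2p4 (n : nat) (hn : 0 < n) (x y : 'S_n) :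
  exists N : nat, n <= N /\
    exists v w : 'S_N,
      [/\ Ptab v = Ptab w,
          (forall i : 'I_N, i < N - n -> v i = w i),
          last_pattern v x
        & last_pattern w y].
Proof.
pose u (z : 'S_n) := staircase n n 0 ++ map (entry n 0) (oneline z).
(* The words [u x] and [u y] have the same letters, so this one prefix completes both to
   permutations of [[0, n * n)]. *)
pose p := [seq i <- iota 0 (n * n) | i \notin u x].
have uniq_u z : uniq (u z).
  by apply: staircase_uniq; rewrite ?(perm_uniq (oneline_perm _ _)) ?iota_uniq.
have mem_u z : u z =i u x.
  move=> a; rewrite !mem_cat; congr (_ || _); apply/eq_mem_map => i.
  by rewrite !(perm_mem (oneline_perm _ _)).
have u_lt a : a \in u x -> a < n * n.
  rewrite mem_cat => /orP[/(allP (staircase_residue n n 0 (leqnn n))) /andP[]//|].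
  case/mapP => i; rewrite (perm_mem (oneline_perm _ _)) mem_iota /entry => iN ->; nia.
have perm_pu z : perm_eq (p ++ u z) (iota 0 (n * n)).
  apply: uniq_perm; rewrite ?iota_uniq //.
    rewrite [uniq (p ++ _)]cat_uniq filter_uniq ?iota_uniq //= uniq_u andbT.
    by apply/hasPn => a; rewrite mem_u mem_filter => /= ->.
  move=> a; rewrite mem_cat mem_u mem_filter mem_iota /=.
  by case: (boolP (a \in u x)) => [/u_lt ->|]; rewrite ?orbF.
have size_pu : size (p ++ staircase n n 0) = n * n - n.
  have := perm_size (perm_pu x); rewrite catA size_cat size_map size_oneline size_iota; lia.
have [v ev] := oneline_surj _ _ (perm_pu x).
have [w ew] := oneline_surj _ _ (perm_pu y).
(* The last [n] letters are the multiples [z i * n], which are ordered like the [z i]. *)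
have pat (z : 'S_n) (t : 'S_(n * n)) : oneline t = p ++ u z -> last_pattern t z.
  move=> et i j ij; rewrite et catA !nth_cat !size_pu !ltnNge !leq_addr /= !addKn.
  rewrite !(nth_map 0) ?size_oneline // !nth_oneline /entry -!ltnNge !addn0.
  by rewrite ltn_pmul2r.
exists (n * n); split; first by rewrite leq_pmulr.
exists v, w; split; [|move=> i iN|exact: pat|exact: pat].
  rewrite /Ptab ev ew; apply: (knuth_eq_catl p) => //.
  by apply: staircase_knuth_eq; rewrite ?oneline_perm.
by apply: val_inj; rewrite /= -!nth_oneline ev ew !catA !nth_cat !size_pu iN.
Qed.
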